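(* Let $X$ be a sofic shift, and let $\mathcal{W} \subseteq L(X)$ be a set of words with the property that for any finite word $v \in L(X)$ there exists some $w \in \mathcal{W}$ such that $v$ is a suffix of $w$. Let $c$ be a letter not appearing in the alphabet of $X$, and let $Y$ be the coded subshift with code words $\{wc : w \in \mathcal{W}\}$. If $|F_Y(n)| \leq n$ for some positive integer $n$, then $Y$ is sofic.
   Context: Let $A$ be a finite set (an alphabet). A subshift on $A$ is a shift-invariant subset $X$ of $A^{\mathbb{Z}}$ that is closed in the product topology. The language $L(X)$ is the set of all finite words which appear in points of $X$, and $L_n(X)$ is the set of words in $L(X)$ of length $n$. A word $w$ is a suffix of a word $u$ if $u = vw$ for some (possibly empty) word $v$. For a subshift $X$ on $A$ and $w \in L(X)$, the follower set $F_X(w)$ is the set of all right-infinite sequences $s \in A^{\mathbb{N}}$ such that the infinite word $ws$ occurs in some point of $X$. For a positive integer $n$, $F_X(n) = \{F_X(w) : w \in L_n(X)\}$ (a set of sets), so $|F_X(n)|$ is the number of distinct follower sets of words of length $n$ in $X$. A subshift is sofic if it is the image of a shift of finite type under a continuous shift-commuting map; equivalently, if $\{F_X(w) : w \in L(X)\}$ is finite. Given a set $\mathcal{V}$ of finite words, the coded subshift with code words $\mathcal{V}$ is the subshift generated by taking the closure of the set of all biinfinite sequences made from concatenating words in $\mathcal{V}$ (all shifts of such sequences included). Here, if $X$ is a subshift on $A$, then $Y$ is a subshift on the alphabet $A \cup \{c\}$. *)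

(* Defs.v *)
From HB Require Import structures.
From mathcomp Require Import all_boot all_order all_algebra.
From mathcomp Require Import boolp classical_sets functions cardinality topology.
Set Implicit Arguments.
Unset Strict Implicit.
Unset Printing Implicit Defensive.
Import Order.TTheory GRing.Theory Num.Theory.
Local Open Scope classical_set_scope.
Local Open Scope ring_scope.

Definition fullshift (A : finType) : Type :=
  prod_topology (fun _ : int => discrete_topology A).

HB.instance Definition _ (A : finType) := Topological.on (fullshift A).

Section Subshifts.
Variable A : finType.
Implicit Types (X : set (fullshift A)) (x : fullshift A) (w : seq A).

Definition shift x : fullshift A := fun i => x (i + 1).

Definition subshift X : Prop := closed X /\ [set shift x | x in X] = X.

(* The word x_i x_(i+1) ... x_(i+n-1). *)
Definition block x (i : int) (n : nat) : seq A :=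
  mkseq (fun j => x (i + j%:Z) : A) n.

Definition occurs_at w x (i : int) : Prop := block x i (size w) = w.

Definition language X : set (seq A) :=
  [set w | exists2 x, X x & exists i, occurs_at w x i].

Definition language_n X (n : nat) : set (seq A) :=
  [set w | language X w /\ size w = n].

Definition follower X w : set (nat -> A) :=
  [set s | exists2 x, X x & exists2 i, occurs_at w x i &
             forall j : nat, s j = x (i + (size w)%:Z + j%:Z)].

Definition follower_n X (n : nat) : set (set (nat -> A)) :=
  [set follower X w | w in language_n X n].

Definition sft X : Prop :=
  exists F : seq (seq A),
    X = [set x | forall w, w \in F -> ~ exists i, occurs_at w x i].

(* The words u_i tile x: u_i occupies the positions k_i <= m < k_(i+1). The
   last clause makes the tiles cover all of Z, even when V has the empty
   word. *)
Definition concatenation (V : set (seq A)) x : Prop :=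
  exists (u : int -> seq A) (k : int -> int),
    [/\ forall i, V (u i),
        forall i, k (i + 1) = k i + (size (u i))%:Z,
        forall i, occurs_at (u i) x (k i) &
        forall m, exists i, k i <= m < k (i + 1)].

Definition coded_subshift (V : set (seq A)) : set (fullshift A) :=
  closure [set x | concatenation V x].

End Subshifts.

(* The factor map is given as a total function f of which only the restriction
   to Z matters. *)
Definition sofic (A : finType) (X : set (fullshift A)) : Prop :=
  subshift X /\
  exists (B : finType) (Z : set (fullshift B)) (f : fullshift B -> fullshift A),
    [/\ sft Z,
        {within Z, continuous f},
        forall z, Z z -> f (shift z) = shift (f z) &
        X = [set f z | z in Z]].

(* The alphabet A with a new letter c is option A, where c is None. *)
Definition code_word (A : finType) (w : seq A) : seq (option A) :=
  rcons (map Some w) None.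

(* Main.v *)
(** A subshift is sofic iff its language L has finitely many sets [extensions L
    u], the finite-word analogue of follower sets (and a function of the
    follower set of u). Two words of Y separated by a letter c can be glued
    independently, so every set of extensions in Y is empty, or that of a
    c-free word v, or that of c v. There are finitely many of the first two
    kinds, as the extensions in Y of a c-free word depend only on its
    extensions in X; call them blind. If those of the third kind were
    infinitely many, then for every k some word v_k of length k would have c
    v_k not blind and not equivalent to c v' for any shorter v': appending
    letters preserves both blindness and equivalence, so otherwise every c v
    would be blind or equivalent to some c v' with v' shorter than k.
    Padding c v_0, ..., c v_(n-1) on the left to length n gives n distinct
    non-blind follower sets, and a c-free word of length n gives one more. *)

Require Import Defs.
From mathcomp Require Import all_boot all_order all_algebra.
From mathcomp Require Import boolp classical_sets functions cardinality topology.
From mathcomp Require Import zify.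
Set Implicit Arguments.
Unset Strict Implicit.
Unset Printing Implicit Defensive.
Import Order.TTheory GRing.Theory Num.Theory.
Local Open Scope classical_set_scope.
Local Open Scope ring_scope.

(** * The topology of the full shift *)

Section Cylinders.
Variable A : finType.
Implicit Types (X Z : set (fullshift A)) (x y z : fullshift A).

Definition agree (N : nat) x y : Prop :=
  forall i : int, (absz i <= N)%N -> y i = x i.

Lemma agree_trans N x y z : agree N x y -> agree N y z -> agree N x z.
Proof. by move=> xy yz i iN; rewrite yz// xy. Qed.

Lemma agreeW M N x y : (M <= N)%N -> agree N x y -> agree M x y.
Proof. by move=> MN xy i iM; apply: xy; apply: leq_trans MN. Qed.

Lemma fullshift_proj_continuous (i : int) :
  continuous (fun x : fullshift A => x i).
Proof. exact: (@proj_continuous _ (fun=> discrete_topology A) i). Qed.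

Lemma nbhs_agree N x : nbhs x (agree N x).
Proof.
have nb i : nbhs x [set y : fullshift A | y i = x i].
  exact: (@fullshift_proj_continuous i x _ (discrete_set1 (x i))).
elim: N => [|N IH].
  by apply: filterS (nb 0) => y yx i; rewrite leqn0 absz_eq0 => /eqP->.
apply: filterS (filterI IH (filterI (nb N.+1%:Z) (nb (- N.+1%:Z)))).
move=> y [yx [/= yp ym]] i iN.
have [/yx//|Ni] := leqP (absz i) N.
have [->|->] : i = N.+1%:Z \/ i = - N.+1%:Z by lia.
  exact: yp.
exact: ym.
Qed.

(** The product topology is the supremum of the initial topologies of the coordinate projections, so
    convergence can be tested one coordinate at a time, and there the space is discrete. *)
Lemma cvg_fullshift (F : set_system (fullshift A)) x : Filter F ->
  (forall i, F [set y | y i = x i]) -> F --> x.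
Proof.
move=> FF Fx.
pose T i := Topological.Pack (Topological.class
  (initial_topology (fun f : (forall i : int, discrete_topology A) => f i))).
apply/(@cvg_sup _ _ (fun i => Topological.class (T i))) => i P.
rewrite (@nbhsE (T i)) => -[B [[C oC <-] Cx] BP].
apply: filterS (Fx i) => y /= yx; apply: BP => /=.
by rewrite /= yx.
Qed.

Lemma nbhs_agreeP x (P : set (fullshift A)) :
  nbhs x P <-> exists N, agree N x `<=` P.
Proof.
split=> [xP|[N NP]]; last exact: filterS (nbhs_agree N x).
(* The filter generated by the central cylinders around [x] converges to [x] coordinatewise, so it
   contains every neighbourhood of [x]. *)
pose G : set_system (fullshift A) := [set Q | exists N, agree N x `<=` Q].
have GF : Filter G.
  split; first by exists 0%N.
    move=> Q R [M MQ] [N NR]; exists (M + N)%N => y xy; split.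
      by apply/MQ/agreeW/xy/leq_addr.
    by apply/NR/agreeW/xy/leq_addl.
  by move=> Q R QR [N NQ]; exists N => y /NQ /QR.
suff : G --> x by move/(_ _ xP).
apply: cvg_fullshift => i; exists (absz i) => y xy /=.
exact: xy.
Qed.

Lemma closure_agreeP X x :
  closure X x <-> forall N, exists2 y, X y & agree N x y.
Proof.
split=> [clx N|h P /nbhs_agreeP[N NP]].
  by have [y [Xy xy]] := clx _ (nbhs_agree N x); exists y.
by have [y Xy xy] := h N; exists y; split => //; exact: NP.
Qed.

Lemma fullshift_compact : compact [set: fullshift A].
Proof.
have := @tychonoff int (fun=> discrete_topology A) (fun=> setT).
have -> : [set f : int -> discrete_topology A |
    forall i : int, [set: discrete_topology A] (f i)] = setT.
  by apply/seteqP; split.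
apply=> i; apply: finite_compact.
exact: (@finite_finset A).
Qed.

End Cylinders.

(* The nontrivial half of the Curtis-Hedlund-Lyndon theorem: z |-> f z 0 is
   locally constant, hence uniformly so on the compact set Z. *)
Lemma continuous_local_rule (A C : finType) (Z : set (fullshift A))
    (f : fullshift A -> fullshift C) :
  closed Z -> {within Z, continuous f} ->
  exists r : nat, forall z z', Z z -> Z z' -> agree r z z' -> f z' 0 = f z 0.
Proof.
move=> cZ fc; apply: contrapT => /forallNP h.
have {}h r : exists p : fullshift A * fullshift A,
  [/\ Z p.1, Z p.2, agree r p.1 p.2 & f p.2 0 <> f p.1 0].
  have /existsNP[z /existsNP[z' /not_implyP[Zz]]] := h r.
  move=> /not_implyP[Zz' /not_implyP[zz' ?]].
  by exists (z, z').
have [p hp] := choice h.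
(* By compactness, the first components of the counterexamples [p r] accumulate at some [z]. *)
have [z [_ clz]] : [set: fullshift A] `&` cluster ((fst \o p) @ \oo) !=set0.
  exact: fullshift_compact filterT.
have Zz : Z z.
  apply: cZ => P zP; have [] := clz Z P _ zP; last by move=> y ?; exists y.
  by exists 0%N => // r _ /=; case: (hp r).
have [N NP] : exists N, forall y, Z y -> agree N z y -> f y 0 = f z 0.
  have : nbhs z [set y | Z y -> f y 0 = f z 0].
    move/subspace_continuousP : fc => /(_ z Zz).
    move=> /(_ [set g | g 0 = f z 0]) /=.
    rewrite /within /=; apply.
    by apply/nbhs_agreeP; exists 0%N => g; apply.
  by move=> /nbhs_agreeP[N NP]; exists N => y Zy /NP; apply.
(* Some [r >= N] has [(p r).1] close to [z]; then [(p r).2] is close to [z] too, and both images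
   take the value [f z 0] at 0. *)
pose tail : set (fullshift A) := [set y | exists2 r, (N <= r)%N & y = (p r).1].
have [] := clz tail (agree N z) _ (nbhs_agree N z).
  by exists N => // r /= Nr; exists r.
move=> _ [[r Nr ->] zr].
have [Z1 Z2 p12] := hp r; apply.
by rewrite !NP//; exact/(agree_trans zr)/(agreeW Nr).
Qed.

(** * Words in subshifts *)

Section Words.
Variable A : finType.
Implicit Types (X : set (fullshift A)) (x y : fullshift A) (u v w t : seq A).

Definition shiftn (d : int) x : fullshift A := fun i => x (i + d).

Lemma shiftnE x : shift x = shiftn 1 x. Proof. by []. Qed.

Lemma shiftnD c d x : shiftn c (shiftn d x) = shiftn (c + d) x.
Proof. by apply: funext => i; rewrite /shiftn addrA. Qed.

Lemma shiftn0 x : shiftn 0 x = x.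
Proof. by apply: funext => i; rewrite /shiftn addr0. Qed.

Lemma subshift_shiftn X d x : subshift X -> X x -> X (shiftn d x).
Proof.
move=> [_ XE].
have h1 y : X y -> X (shiftn 1 y) by move=> Xy; rewrite -XE; exists y.
have hN y : X y -> X (shiftn (- 1) y).
  by rewrite -{1}XE => -[z Xz <-]; rewrite shiftnE shiftnD addNr shiftn0.
move=> Xx; elim: d => [|d IH|d IH]; first by rewrite shiftn0.
  by rewrite -add1n PoszD -shiftnD; exact: h1.
by rewrite -add1n PoszD opprD -shiftnD; exact: hN.
Qed.

Lemma eq_block x y i j n :
  (forall k, (k < n)%N -> x (i + k%:Z) = y (j + k%:Z)) ->
  block x i n = block y j n.
Proof.
move=> h; apply/eq_in_map => k; rewrite mem_iota => kn; exact: h.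
Qed.

Lemma block_shiftn d x i n : block (shiftn d x) i n = block x (i + d) n.
Proof. by apply: eq_block => k _; rewrite /shiftn addrAC. Qed.

Lemma size_block x i n : size (block x i n) = n.
Proof. exact: size_mkseq. Qed.

Lemma blockD x i m n :
  block x i (m + n) = block x i m ++ block x (i + m%:Z) n.
Proof.
rewrite /block /mkseq iotaD map_cat; congr (_ ++ _).
rewrite add0n -[X in iota X _]addn0 iotaDl -map_comp; apply: eq_map => j /=.
by rewrite PoszD addrA.
Qed.

Lemma occurs_at_block x i n : occurs_at (block x i n) x i.
Proof. by rewrite /occurs_at size_block. Qed.

Lemma occurs_at_cat u v x i :
  occurs_at (u ++ v) x i <-> occurs_at u x i /\ occurs_at v x (i + (size u)%:Z).
Proof.
rewrite /occurs_at size_cat blockD; split=> [/eqP|[-> ->]//].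
by rewrite eqseq_cat ?size_block// => /andP[/eqP ? /eqP].
Qed.

Lemma occurs_at_shiftn w d x i :
  occurs_at w (shiftn d x) i <-> occurs_at w x (i + d).
Proof. by rewrite /occurs_at block_shiftn. Qed.

Lemma eq_occurs_at w x y i j :
  (forall k, (k < size w)%N -> x (i + k%:Z) = y (j + k%:Z)) ->
  occurs_at w x i -> occurs_at w y j.
Proof. by move=> /eq_block; rewrite /occurs_at => ->. Qed.

Lemma language_factor X u v w : language X (u ++ v ++ w) -> language X v.
Proof.
move=> [x Xx [i /occurs_at_cat[_ /occurs_at_cat[h _]]]].
by exists x => //; eexists; exact: h.
Qed.

Lemma language_suffix X u v : language X (u ++ v) -> language X v.
Proof. by rewrite -[u ++ v]cats0 -catA; exact: language_factor. Qed.

Lemma language_prefix X u v : language X (u ++ v) -> language X u.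
Proof. exact: (@language_factor _ [::]). Qed.

Lemma language_block X x i n : X x -> language X (block x i n).
Proof. by move=> Xx; exists x => //; exists i; exact: occurs_at_block. Qed.

Lemma mem_of_language X x : subshift X ->
  (forall i n, language X (block x i n)) -> X x.
Proof.
move=> sX h; case: (sX) => cX _; apply: cX.
apply/closure_agreeP => N.
have [y Xy [i]] := h (- N%:Z) (N + N).+1; rewrite /occurs_at size_block => e.
(* The block of [x] on [-N, N] starts at [i] in [y]; this shift moves its start back to -N. *)
exists (shiftn (i + N%:Z) y); first exact: subshift_shiftn.
move=> j jN; rewrite /shiftn.
have := congr1 (fun s => nth (x 0) s (absz (j + N%:Z))) e.
rewrite !nth_mkseq; try lia.
move=> e1; transitivity (y (i + (absz (j + N%:Z))%:Z)).
  by congr (y _); lia.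
by rewrite e1; congr (x _); lia.
Qed.

End Words.

Definition extensions (T : Type) (L : set (seq T)) (u : seq T) : set (seq T) :=
  [set t | L (u ++ t)].

(** * Sofic shifts and sets of extensions *)

Section SoficExtensions.
Variables (A B : finType) (F : seq (seq B)).
Let Z : set (fullshift B) :=
  [set z | forall w, w \in F -> ~ exists i, occurs_at w z i].
Variables (f : fullshift B -> fullshift A).
Hypothesis f_shift : forall z, Z z -> f (shift z) = shift (f z).

Lemma sft_shiftn d z : Z z -> Z (shiftn d z).
Proof.
by move=> Zz w wF [i /occurs_at_shiftn wz]; apply: (Zz w wF); exists (i + d).
Qed.

Lemma sft_closed : closed Z.
Proof.
move=> z /closure_agreeP clz w wF [i wz].
have [y Zy zy] := clz (absz i + size (w : seq B))%N.
apply: (Zy w wF); exists i; apply: eq_occurs_at wz => k kw.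
by rewrite zy//; lia.
Qed.

Lemma factor_map_shiftn d z : Z z -> f (shiftn d z) = shiftn d (f z).
Proof.
have h n y : Z y -> f (shiftn n%:Z y) = shiftn n%:Z (f y).
  move=> Zy; elim: n => [|n IH]; first by rewrite !shiftn0.
  rewrite -add1n PoszD -!shiftnD -shiftnE f_shift ?IH//.
  exact: sft_shiftn.
move=> Zz; case: d => [d|d]; first exact: h.
rewrite NegzE.
have := h d.+1 _ (@sft_shiftn (- d.+1%:Z) _ Zz).
by rewrite shiftnD subrr shiftn0 => ->; rewrite shiftnD addNr shiftn0.
Qed.

Variable r : nat.
Hypothesis f_local :
  forall z z', Z z -> Z z' -> agree r z z' -> f z' 0 = f z 0.

Lemma factor_map_local i z z' : Z z -> Z z' ->
  (forall j, (absz j <= r)%N -> z' (j + i) = z (j + i)) -> f z' i = f z i.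
Proof.
move=> Zz Zz' zz'.
have := f_local (@sft_shiftn i _ Zz) (@sft_shiftn i _ Zz') zz'.
by rewrite !factor_map_shiftn// /shiftn add0r.
Qed.

(* Points of Z agreeing on [-K, K) can be spliced at 0, within Z and compatibly
   with f.  So the extensions of u only depend on the windows around 0 of the
   points of Z whose image ends a copy of u just before 0. *)
Lemma factor_extensions_finite :
  finite_set (range (extensions (language [set f z | z in Z]))).
Proof.
(* Forbidden words have length at most [K], so one occurring in the splice [y] below lies where [y]
   agrees with [z] or where it agrees with [z']. Since [r <= K], the local rule sees [y] as [z] at
   negative positions and as [z'] at the others. *)
pose K := (r + \max_(w <- F) size w)%N.
have FK (w : seq B) : w \in F -> (size w <= K)%N.
  move=> wF; apply: leq_trans (leq_addl _ _).
  by rewrite (big_rem w)//= leq_maxl.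
pose win (z : fullshift B) : {ffun 'I_(K + K) -> B} :=
  [ffun j : 'I_(K + K) => z ((j : nat)%:Z - K%:Z) : B].
pose past u : {ffun {ffun 'I_(K + K) -> B} -> bool} :=
  [ffun b : {ffun 'I_(K + K) -> B} => `[< exists z, [/\ Z z, win z = b &
     occurs_at u (f z) (- (size u)%:Z)] >]].
pose G (S : {ffun {ffun 'I_(K + K) -> B} -> bool}) : set (seq A) :=
  [set t | exists z, [/\ Z z, S (win z) & occurs_at t (f z) 0]].
have extE u : extensions (language [set f z | z in Z]) u = G (past u).
  apply/seteqP; split=> t.
    move=> [_ [z Zz <-] [i ut]].
    have Z1 := @sft_shiftn (i + (size u)%:Z) _ Zz.
    have : occurs_at (u ++ t) (f (shiftn (i + (size u)%:Z) z)) (- (size u)%:Z).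
      rewrite factor_map_shiftn//; apply/occurs_at_shiftn.
      by rewrite addrC addrK.
    move=> /occurs_at_cat[uz tz].
    exists (shiftn (i + (size u)%:Z) z); split=> //.
      by rewrite ffunE; apply/asboolP; exists (shiftn (i + (size u)%:Z) z).
    by rewrite addNr in tz.
  move=> [z' [Zz' + tz']]; rewrite ffunE => /asboolP[z [Zz ww uz]].
  have zz' i : - K%:Z <= i < K%:Z -> z i = z' i.
    move=> iK.
    have iK' : (absz (i + K%:Z)%R < K + K)%N by lia.
    have /ffunP/(_ (Ordinal iK')) := ww; rewrite !ffunE /=.
    by have -> : (absz (i + K%:Z))%:Z - K%:Z = i by lia.
  pose y : fullshift B := fun i => if i < 0 then z i else z' i.
  have yz i : i < K%:Z -> y i = z i.
    by rewrite /y; case: ifPn => // i0 iK; rewrite zz'//; lia.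
  have yz' i : - K%:Z <= i -> y i = z' i.
    by rewrite /y; case: ifPn => // i0 iK; rewrite zz'//; lia.
  have Zy : Z y.
    move=> w wF [i wy]; have wK := FK _ wF.
    have [iK|iK] := leP (- K%:Z) i.
      apply: (Zz' w wF); exists i; apply: eq_occurs_at wy => k kw.
      by rewrite yz'//; lia.
    apply: (Zz w wF); exists i; apply: eq_occurs_at wy => k kw.
    by rewrite yz//; lia.
  exists (f y); first by exists y.
  exists (- (size u)%:Z); apply/occurs_at_cat; split.
    apply: eq_occurs_at uz => k ku; apply: factor_map_local => // j jr.
    by rewrite yz//; lia.
  rewrite addNr.
  apply: eq_occurs_at tz' => k kt; apply: factor_map_local => // j jr.
  by rewrite yz'//; lia.
apply: (@sub_finite_set _ _ (range G)); last exact: finite_image.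
by move=> _ [u _ <-]; exists (past u).
Qed.

End SoficExtensions.

Lemma sofic_extensions_finite (A : finType) (X : set (fullshift A)) :
  sofic X -> finite_set (range (extensions (language X))).
Proof.
move=> [_ [B [_ [f [[F ->] fc fs ->]]]]].
have [r rP] := continuous_local_rule (@sft_closed _ F) fc.
exact: factor_extensions_finite fs _ rP.
Qed.

(** A decreasing sequence with finitely many values is eventually constant, so its intersection is
    one of its terms. *)
Lemma finite_decreasing_limit (T : Type) (Q : set (set T)) (g : nat -> set T) :
  finite_set Q -> (forall n, Q (g n)) -> (forall n, g n.+1 `<=` g n) ->
  Q [set t | forall n, g n t].
Proof.
move=> /finite_seqP[s ->] Qg gS.
have gW m n : (m <= n)%N -> g n `<=` g m.
  elim: n => [|n IH]; first by rewrite leqn0 => /eqP->.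
  by rewrite leq_eqVlt => /predU1P[->//|/IH mn] t /gS/mn.
(* Any set of [s] that fails to lie in some [g N] already fails to lie in [g M]. Applied to [g M]
   itself, this puts [g M] inside every [g n]. *)
have [M MP] : exists M, forall q, q \in s ->
    forall N, ~ q `<=` g N -> ~ q `<=` g M.
  elim: {Qg} s => [|q s [M MP]]; first by exists 0%N.
  have [[N qN]|/forallNP qN] := pselect (exists N, ~ q `<=` g N).
    exists (maxn M N) => p; rewrite inE => /predU1P[->|ps] L pL pM.
      by apply/qN/(subset_trans pM)/gW/leq_maxr.
    by apply: (MP p ps L pL); apply/(subset_trans pM)/gW/leq_maxl.
  exists M => p; rewrite inE => /predU1P[-> N /qN//|]; exact: MP.
rewrite (_ : mkset _ = g M); first exact: Qg.
apply/seteqP; split=> [t /(_ M)//|t gMt n].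
by have [|/(MP _ (Qg M))] := pselect (g M `<=` g n); [apply | case].
Qed.

(** * The follower set graph as a presentation of a subshift *)

Section FiniteExtensionsSofic.
Variables (C : finType) (Y : set (fullshift C)) (s : seq (set (seq C))).
Hypothesis sY : subshift Y.
Hypothesis rangeE : range (extensions (language Y)) = [set` s].

(** The vertices of the graph are the sets of extensions, and the letter a leads from E to the set
    of t with a t in E. Points of [Z] are the bi-infinite paths, coded by their edges: a pair is a
    vertex and the letter read when leaving it. A vertex must contain the empty word, which excludes
    the set of extensions of a word outside the language. *)
Let state (i : 'I_(size s)) : set (seq C) := nth set0 s i.
Let edge : finType := ('I_(size s) * C)%type.
Let linked (b b' : edge) : Prop :=
  state b'.1 = [set t | state b.1 (b.2 :: t)].

Let forbidden : seq (seq edge) :=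
  [seq [:: b] | b <- enum edge & ~~ `[< state b.1 [::] >]] ++
  [seq [:: p.1; p.2] | p <- enum {: edge * edge} & ~~ `[< linked p.1 p.2 >]].

Let Z : set (fullshift edge) :=
  [set z | forall w, w \in forbidden -> ~ exists i, occurs_at w z i].

Let label (z : fullshift edge) : fullshift C := fun i => (z i).2.

Lemma edge_shiftP z :
  Z z <-> forall i, state (z i).1 [::] /\ linked (z i) (z (i + 1)).
Proof.
split=> [Zz i|h w].
  split; apply: contrapT => nz.
    apply: (Zz [:: z i]); last first.
      by exists i; rewrite /occurs_at /block /mkseq /= addr0.
    rewrite mem_cat map_f//= mem_filter mem_enum andbT.
    exact/asboolPn.
  apply: (Zz [:: z i; z (i + 1)]); last first.
    by exists i; rewrite /occurs_at /block /mkseq /= addr0.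
  rewrite mem_cat; apply/orP; right.
  apply/mapP; exists (z i, z (i + 1)) => //.
  by rewrite mem_filter mem_enum andbT; exact/asboolPn.
rewrite mem_cat => /orP[] /mapP[b];
    rewrite mem_filter => /andP[/asboolPn nb _] ->.
  by move=> [i [zb]]; apply: nb; rewrite -zb addr0; case: (h i).
by move=> [i [z1 z2]]; apply: nb; rewrite -z1 -z2 addr0; case: (h i).
Qed.

Lemma label_continuous : continuous label.
Proof.
move=> z; apply: cvg_fullshift => [|i].
  have nbhs_z := @nbhs_filter (fullshift edge) z.
  exact: (@fmap_filter _ (fullshift C) label _ nbhs_z).
apply: filterS (nbhs_agree (absz i) z) => y zy /=.
by rewrite /label zy.
Qed.

Lemma state_block z i n : Z z ->
  state (z (i + n%:Z)).1 = [set t | state (z i).1 (block (label z) i n ++ t)].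
Proof.
move=> /edge_shiftP Zz; elim: n => [|n IH]; first by rewrite addr0.
rewrite intS [X in i + X]addrC addrA; have [_ ->] := Zz (i + n%:Z).
rewrite IH; apply: eq_set => t.
by rewrite -[n.+1]addn1 blockD -catA /block /mkseq /= addr0.
Qed.

(* The state at i of a path labelled y is the intersection over n of the sets of
   extensions of the n letters of y before i: by finiteness this decreasing
   intersection is itself a set of extensions. *)
Lemma label_image : Y = [set label z | z in Z].
Proof.
have stateP q : (exists i, state i = q) <-> range (extensions (language Y)) q.
  rewrite rangeE; split=> [[i <-]|]; first exact: mem_nth.
  move=> /= qs; have qs' := qs; rewrite -index_mem in qs'.
  by exists (Ordinal qs'); rewrite /state nth_index.
apply/seteqP; split=> [y Yy|_ [z Zz <-]]; last first.
  apply: mem_of_language => // i n.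
  (* If the state at [i] is the set of extensions of [u], then the state at [i + n] containing the
     empty word says that [u] followed by the [n] labels read is in the language. *)
  have [u _ uE] : range (extensions (language Y)) (state (z i).1).
    by apply/stateP; exists (z i).1.
  have /edge_shiftP/(_ (i + n%:Z))[+ _] := Zz.
  rewrite state_block//= -uE /extensions /=.
  exact: language_factor.
pose g i n := extensions (language Y) (block y (i - n%:Z) n).
have gS i n : g i n.+1 `<=` g i n.
  move=> t; rewrite /g /extensions /mkset -[n.+1]add1n blockD -catA => h.
  move/language_suffix : h.
  by have -> : i - (1 + n)%N%:Z + 1%:Z = i - n%:Z by lia.
pose lim i := [set t | forall n, g i n t].
have limS i : lim (i + 1) = [set t | lim i (y i :: t)].
  have gcons n t : g (i + 1) n.+1 t = g i n (y i :: t).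
    rewrite /g /extensions /mkset.
    have -> : i + 1 - n.+1%:Z = i - n%:Z by lia.
    by rewrite -[n.+1]addn1 blockD subrK -catA /block /mkseq /= addr0.
  (* The index shift in [gcons] is harmless because the sets [g (i + 1) n] decrease with [n]. *)
  apply/seteqP; split=> t /= h n; first by rewrite -gcons; exact: h.
  by apply: gS; rewrite gcons.
have /choice[st stE] i : exists j, state j = lim i.
  apply/stateP.
  apply: finite_decreasing_limit (gS i); first by rewrite rangeE.
  by move=> n; exists (block y (i - n%:Z) n).
exists (fun i => (st i, y i)) => //.
apply/edge_shiftP => i /=; split; last by rewrite /linked /= !stE.
rewrite stE => n; rewrite /g /extensions /mkset cats0; exact: language_block.
Qed.

Lemma finite_extensions_sofic_seq : sofic Y.
Proof.
split=> //; exists edge, Z, label; split => //.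
- by exists forbidden.
- exact/continuous_subspaceT/label_continuous.
- exact: label_image.
Qed.

End FiniteExtensionsSofic.

Lemma finite_extensions_sofic (C : finType) (Y : set (fullshift C)) :
  subshift Y -> finite_set (range (extensions (language Y))) -> sofic Y.
Proof.
by move=> sY /finite_seqP[s sE]; exact: finite_extensions_sofic_seq sE.
Qed.

(** * The language of a coded subshift *)

Section Tilings.
Variable C : finType.
Implicit Types (V : set (seq C)) (x : fullshift C).
Implicit Types (u : int -> seq C) (k : int -> int).

Lemma concatenation_shiftn V d x :
  concatenation V x -> concatenation V (shiftn d x).
Proof.
move=> [u [k [Vu kS ux cover]]]; exists u, (fun i => k i - d); split=> //.
- by move=> i; rewrite kS addrAC.
- by move=> i; apply/occurs_at_shiftn; rewrite subrK.
- by move=> m; have [i ki] := cover (m + d); exists i; lia.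
Qed.

Lemma coded_subshift_subshift V : subshift (coded_subshift V).
Proof.
split; first exact: closed_closure.
have h d x : coded_subshift V x -> coded_subshift V (shiftn d x).
  move=> /closure_agreeP clx; apply/closure_agreeP => N.
  have [y Vy xy] := clx (N + absz d)%N.
  exists (shiftn d y); first exact: concatenation_shiftn.
  by move=> i iN; apply: xy; lia.
apply/seteqP; split=> [_ [x Vx <-]|x Vx]; first exact: h.
by exists (shiftn (-1) x); [exact: h|rewrite shiftnE shiftnD subrr shiftn0].
Qed.

Lemma language_closure (S : set (fullshift C)) :
  language (closure S) = language S.
Proof.
apply/seteqP; split=> w [x Sx [i wx]].
  have /closure_agreeP/(_ (absz i + size (w : seq C))%N)[y Sy xy] := Sx.
  exists y => //; exists i; apply: eq_occurs_at wx => k kw.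
  by rewrite xy//; lia.
by exists x; [exact: subset_closure|exists i].
Qed.

Lemma tiling_le u k i n : (forall i, k (i + 1) = k i + (size (u i))%:Z) ->
  k i <= k (i + n%:Z).
Proof.
move=> kS; elim: n => [|n IH]; first by rewrite addr0.
rewrite intS [1 + _]addrC addrA kS; by apply: le_trans IH _; rewrite lerDl.
Qed.

Lemma occurs_at_tiles u k x a m :
  (forall i, k (i + 1) = k i + (size (u i))%:Z) ->
  (forall i, occurs_at (u i) x (k i)) ->
  occurs_at (flatten (mkseq (fun j => u (a + j%:Z)) m)) x (k a) /\
  k (a + m%:Z) = k a + (size (flatten (mkseq (fun j => u (a + j%:Z)) m)))%:Z.
Proof.
move=> kS ux; elim: m => [|m [IHo IHk]]; first by rewrite !addr0.
rewrite mkseqS flatten_rcons; split.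
  by apply/occurs_at_cat; rewrite -IHk.
by rewrite intS [1 + _]addrC addrA kS IHk size_cat PoszD addrA.
Qed.

Lemma coded_language_flatten V z : language (coded_subshift V) z ->
  exists2 vs : seq (seq C), (forall v, v \in vs -> V v) &
    exists p q, flatten vs = p ++ z ++ q.
Proof.
rewrite language_closure => -[x [u [k [Vu kS ux cover]]] [i zx]].
(* The tile [a] holds the first position of [z] and the tile [b] the position just after [z], so the
   tiles from [a] to [b] cover the occurrence, also when [z] is empty. *)
have [a /andP[ai ia]] := cover i.
have [b /andP[bi ib]] := cover (i + (size z)%:Z).
have ab : a <= b.
  rewrite leNgt; apply/negP => ba.
  have := tiling_le (b + 1) (absz (a - (b + 1))%R) kS.
  have -> : b + 1 + (absz (a - (b + 1))%R)%:Z = a by lia.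
  by lia.
have [] := @occurs_at_tiles u k x a (absz (b + 1 - a)%R) kS ux.
have -> : a + (absz (b + 1 - a)%R)%:Z = b + 1 by lia.
set vs := mkseq _ _ => vsx kb.
exists vs; first by move=> v /mapP[j _ ->].
exists (block x (k a) (absz (i - k a)%R)).
exists (block x (i + (size z)%:Z) (absz (k (b + 1) - (i + (size z)%:Z))%R)).
rewrite -{1}vsx.
have -> : size (flatten vs) = (absz (i - k a)%R +
  (size z + absz (k (b + 1) - (i + (size z)%:Z))%R))%N by lia.
rewrite blockD; have -> : k a + (absz (i - k a)%R)%:Z = i by lia.
by rewrite blockD (zx : block x i (size z) = z).
Qed.

Lemma tiling_exists u : (forall i, (0 < size (u i))%N) ->
  exists x k, [/\ k 0 = 0, forall i, k (i + 1) = k i + (size (u i))%:Z,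
    forall i, occurs_at (u i) x (k i) &
    forall m, exists i, k i <= m < k (i + 1)].
Proof.
move=> u0.
(* The start of tile [i] is the signed total length of the tiles between 0 and [i]; as [Negz n] is
   -(n+1), the tiles -1, ..., -(n+1) are counted there. *)
pose k i : int := match i with
  | Posz n => (\sum_(0 <= j < n) size (u j%:Z))%N%:Z
  | Negz n => - (\sum_(0 <= j < n.+1) size (u (Negz j)))%N%:Z
  end.
have k0 : k 0 = 0 by rewrite /k /= big_geq.
have kS i : k (i + 1) = k i + (size (u i))%:Z.
  case: i => [n|[|n]].
  - have -> : n%:Z + 1 = n.+1%:Z by lia.
    by rewrite /k big_nat_recr//= PoszD.
  - by rewrite k0 /k big_nat1; lia.
  - have -> : Negz n.+1 + 1 = Negz n by lia.
    by rewrite /k [in RHS]big_nat_recr//= PoszD; lia.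
(* Tiles are nonempty, so a step by one position stays in the tile or enters a neighbouring one. *)
have cover m : exists i, k i <= m < k (i + 1).
  elim: m => [|m [i /andP[im mi]]|m [i /andP[im mi]]].
  - by exists 0; rewrite kS k0; have := u0 0; lia.
  - have [mi'|mi'] := ltP m.+1%:Z (k (i + 1)); first by exists i; lia.
    by exists (i + 1); rewrite [k (i + 1 + 1)]kS; have := u0 (i + 1); lia.
  - have [mi'|mi'] := leP (k i) (- m.+1%:Z); first by exists i; lia.
    exists (i - 1); have := kS (i - 1); rewrite subrK; have := u0 (i - 1); lia.
have [t tP] := choice cover.
have a0 : C by case: (u 0) (u0 0).
(* Position [m] is read off its tile [t m], where the index is in range, so [a0] is never
   returned. *)
exists (fun m => nth a0 (u (t m)) (absz (m - k (t m))%R)), k; split=> // i.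
apply: (@eq_from_nth _ a0); first exact: size_block.
move=> j; rewrite size_block => ju; rewrite nth_mkseq//.
suff -> : t (k i + j%:Z) = i by congr nth; lia.
have /andP[h1 h2] := tP (k i + j%:Z).
move: (t _) h1 h2 => l h1 h2; apply/eqP; rewrite eq_le; apply/andP; split.
  rewrite leNgt; apply/negP => il.
  have := tiling_le (i + 1) (absz (l - (i + 1))%R) kS.
  have -> : i + 1 + (absz (l - (i + 1))%R)%:Z = l by lia.
  by rewrite kS; lia.
rewrite leNgt; apply/negP => li.
have := tiling_le (l + 1) (absz (i - (l + 1))%R) kS.
have -> : l + 1 + (absz (i - (l + 1))%R)%:Z = i by lia.
by lia.
Qed.

Lemma flatten_coded_language V v0 (vs : seq (seq C)) :
  (forall v, V v -> (0 < size v)%N) -> V v0 -> (forall v, v \in vs -> V v) ->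
  language (coded_subshift V) (flatten vs).
Proof.
move=> V0 Vv0 Vvs; rewrite language_closure.
(* The given words become the tiles 0, 1, ..., and [v0] fills both sides. *)
pose u (i : int) := if i is Posz n then nth v0 vs n else v0.
have Vu i : V (u i).
  case: i => // n /=; have [nvs|nvs] := ltnP n (size vs).
    by apply/Vvs/mem_nth.
  by rewrite nth_default.
have [x [k [k0 kS ux cover]]] := tiling_exists (fun i => V0 _ (Vu i)).
exists x; first by exists u, k.
exists (k 0).
have [+ _] := @occurs_at_tiles u k x 0 (size vs) kS ux.
suff -> : mkseq (fun j => u (0 + j%:Z)) (size vs) = vs by [].
apply: (@eq_from_nth _ v0); rewrite size_mkseq// => j jvs.
by rewrite nth_mkseq// add0r.
Qed.

End Tilings.

(** * Code words ending in a new letter *)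

Section OptionWords.
Variable A : finType.
Implicit Types (v w : seq A) (p q s t z : seq (option A)) (ws : seq (seq A)).

Lemma split_first_None t :
  (exists v, t = map Some v) \/ (exists v q, t = map Some v ++ None :: q).
Proof.
elim: t => [|[a|] t IH]; first by left; exists [::].
  case: IH => [[v ->]|[v [q ->]]]; first by left; exists (a :: v).
  by right; exists (a :: v), q.
by right; exists [::], t.
Qed.

Lemma split_last_None t :
  (exists v, t = map Some v) \/ (exists p v, t = p ++ None :: map Some v).
Proof.
elim/last_ind: t => [|t [a|] IH]; first by left; exists [::].
  case: IH => [[v ->]|[p [v ->]]].
    by left; exists (rcons v a); rewrite map_rcons.
  by right; exists p, (rcons v a); rewrite map_rcons rcons_cat.
by right; exists t, [::]; rewrite cats1.
Qed.

(** The c displayed on the left is the first one of the word, so the c on the right is either that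
    one or a later one. *)
Lemma split_at_None w s p q :
  map Some w ++ None :: s = p ++ None :: q ->
  (p = map Some w /\ q = s) \/
  (exists p', p = map Some w ++ None :: p' /\ s = p' ++ None :: q).
Proof.
elim: w p => [|a w IH] [|b p] //=; first by move=> [->]; left.
  by move=> [<- ->]; right; exists p.
by move=> [<- /IH[[-> ->]|[p' [-> ->]]]]; [left|right; exists p'].
Qed.

Lemma prefix_map_Some w v s q :
  map Some w ++ None :: s = map Some v ++ q -> prefix v w.
Proof.
elim: w v => [|a w IH] [|b v]//= [<- /IH vw].
by rewrite eqxx.
Qed.

(** A c-free factor cannot straddle the first c. *)
Lemma infix_map_Some w v s p q :
  map Some w ++ None :: s = p ++ map Some v ++ q ->
  infix v w \/ exists p', s = p' ++ map Some v ++ q.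
Proof.
elim: w p => [|a w IH] [|b p].
- by move/(@prefix_map_Some [::])/prefixW; left.
- by move=> [_ ->]; right; exists p.
- by move/(@prefix_map_Some (a :: w))/prefixW; left.
- by move=> [_ /IH[vw|]]; [left; rewrite /= vw orbT|right].
Qed.

Definition codes ws : seq (option A) := flatten (map (@code_word A) ws).

Lemma codes_cons w ws : codes (w :: ws) = map Some w ++ None :: codes ws.
Proof. by rewrite /codes /= /code_word cat_rcons. Qed.

Lemma codes_cat ws1 ws2 : codes (ws1 ++ ws2) = codes ws1 ++ codes ws2.
Proof. by rewrite /codes map_cat flatten_cat. Qed.

(** Each c ends a code word, so a cut just after any c leaves two concatenations of code words. *)
Lemma codes_split ws p q : codes ws = p ++ None :: q ->
  exists ws1 ws2,
    [/\ ws = ws1 ++ ws2, codes ws1 = rcons p None & codes ws2 = q].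
Proof.
elim: ws p => [|w ws IH] p; first by case: p.
rewrite codes_cons => /split_at_None[[-> ->]|].
  by exists [:: w], ws; rewrite codes_cons -cats1.
move=> [p' [-> /IH[ws1 [ws2 [-> e1 e2]]]]].
by exists (w :: ws1), ws2; rewrite codes_cons e1 rcons_cat rcons_cons.
Qed.

Lemma codes_infix ws p v q : codes ws = p ++ map Some v ++ q ->
  v = [::] \/ exists2 w, w \in ws & infix v w.
Proof.
elim: ws p => [|w ws IH] p.
  by case: p => //; case: v => //; left.
rewrite codes_cons => /infix_map_Some[vw|[p' /IH[->|[w' w'ws vw']]]].
- by right; exists w; rewrite ?mem_head.
- by left.
- by right; exists w' => //; rewrite inE w'ws orbT.
Qed.

End OptionWords.

(** * Sets of extensions in [Y] and the counting argument *)

Lemma extensions_follower (C : finType) (Y : set (fullshift C)) (z : seq C) :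
  extensions (language Y) z =
  [set t | exists2 s, follower Y z s & mkseq s (size t) = t].
Proof.
apply/seteqP; split=> t.
  move=> [x Yx [i /occurs_at_cat[zx tx]]].
  exists (fun j => x (i + (size z)%:Z + j%:Z)) => //.
  by exists x => //; exists i.
move=> [s [x Yx [i zx sx]] st]; exists x => //; exists i.
apply/occurs_at_cat; split=> //; rewrite /occurs_at -[RHS]st.
by apply: eq_map => j; rewrite sx.
Qed.

Lemma extensions_cat (T : Type) (L : set (seq T)) u t :
  extensions L (u ++ t) = [set s | extensions L u (t ++ s)].
Proof. by apply: eq_set => s; rewrite /extensions /= catA. Qed.

Lemma new_class_of_size (A : finType) (T : Type) (E : seq A -> T) (D : set T) :
  finite_set D ->
  (forall v v' t, E v = E v' -> E (v ++ t) = E (v' ++ t)) ->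
  (forall v t, D (E v) -> D (E (v ++ t))) ->
  ~ finite_set (range E) ->
  forall k, exists v, [/\ size v = k, ~ D (E v) &
    forall v', (size v' < k)%N -> E v' <> E v].
Proof.
move=> Dfin Ecat Dcat Einf k; apply: contrapT => /forallNP none; apply: Einf.
have old v : size v = k -> D (E v) \/ exists2 v', (size v' < k)%N & E v' = E v.
  move=> vk; have [Dv|Dv] := pselect (D (E v)); [by left|right].
  apply: contrapT => none_v; apply: (none v); split=> // v' v'k v'v.
  by apply: none_v; exists v'.
(* Replacing the prefix of length [k] by a shorter word of the same class keeps the class of [v] and
   shortens it; this repeats until the length drops below [k], or a prefix falls in [D] and takes
   [v] along. *)
have all_old m v : (size v <= m)%N ->
    D (E v) \/ exists2 v', (size v' < k)%N & E v' = E v.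
  elim: m v => [|m IH] v vm; have [vk|kv] := ltnP (size v) k;
    try by right; exists v.
    by apply: old; lia.
  rewrite (_ : E v = E (take k v ++ drop k v)); last by rewrite cat_take_drop.
  have [Dv|[v' v'k /Ecat <-]] := old _ (size_takel kv).
    by left; exact: Dcat.
  by apply: IH; rewrite size_cat size_drop; lia.
apply: (@sub_finite_set _ _
    (D `|` [set E (v : seq A) | v in [set: k.-bseq A]])).
  move=> _ [v _ <-].
  have [|[v' v'k <-]] := all_old _ v (leqnn _); [by left|right].
  by exists (Bseq (ltnW v'k)).
by rewrite finite_setU; split=> //; exact: finite_image.
Qed.

Section CodedSofic.
Variables (A : finType) (X : set (fullshift A)) (W : set (seq A)) (w0 : seq A).
Hypotheses (Ww0 : W w0) (WX : W `<=` language X).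
Hypothesis suffW : forall v, language X v -> exists w, W w /\ suffix v w.
Let Y := coded_subshift [set code_word w | w in W].

Lemma language_codesP z :
  language Y z <-> exists2 ws : seq (seq A), (forall w, w \in ws -> W w) &
    exists p q, codes ws = p ++ z ++ q.
Proof.
split=> [/coded_language_flatten[vs Vvs [p [q e]]]|[ws Wws [p [q e]]]].
  have [ws Wws vsE] : exists2 ws : seq (seq A), (forall w, w \in ws -> W w) &
      vs = map (@code_word A) ws.
    elim: {e} vs Vvs => [|v vs IH] Vvs; first by exists [::].
    have [|ws Wws ->] := IH.
      by move=> w wvs; apply: Vvs; rewrite inE wvs orbT.
    have [w Ww <-] := Vvs v (mem_head _ _).
    by exists (w :: ws) => // w'; rewrite inE => /predU1P[->//|/Wws].
  by exists ws => //; exists p, q; rewrite /codes -vsE.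
apply: (@language_factor _ _ p _ q); rewrite -e /codes.
apply: (@flatten_coded_language _ _ (code_word w0)).
- by move=> _ [w _ <-]; rewrite size_rcons.
- by exists w0.
- by move=> _ /mapP[w wws ->]; exists w => //; exact: Wws.
Qed.

(** Cut one concatenation of code words just after the c that follows [p], the other just after the
    c that precedes [q], and join the left part of the first to the right part of the second. *)
Lemma language_glue p q :
  language Y (p ++ None :: q) <->
  language Y (rcons p None) /\ language Y (None :: q).
Proof.
split=> [h|[]].
  split; last exact: language_suffix h.
  by move: h; rewrite -cat_rcons; exact: language_prefix.
move=> /language_codesP[ws Wws [p1 [q1 e]]].
move=> /language_codesP[ws' Wws' [p2 [q2 e']]].
rewrite cat_rcons catA in e.
have [ws1 [ws2 [wsE e1 _]]] := codes_split e.
have [ws3 [ws4 [ws'E _ e4]]] := codes_split e'.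
apply/language_codesP; exists (ws1 ++ ws4).
  move=> w; rewrite mem_cat => /orP[w1|w4].
    by apply: Wws; rewrite wsE mem_cat w1.
  by apply: Wws'; rewrite ws'E mem_cat w4 orbT.
exists p1, q2.
by rewrite codes_cat e1 e4 -!cats1 -!catA.
Qed.

Lemma language_Some_rcons v :
  language X v -> language Y (rcons (map Some v) None).
Proof.
move=> /suffW[w [Ww /suffixP[u uw]]].
apply/language_codesP; exists [:: w]; first by move=> w'; rewrite inE => /eqP->.
exists (map Some u), [::].
by rewrite codes_cons uw map_cat cats0 -cats1 -!catA.
Qed.

(** A nonempty c-free factor lies inside one code word, hence inside a word of [W]; the converse
    rests on the suffix property of [W]. *)
Lemma language_Some v : language Y (map Some v) <-> language X v.
Proof.
split=> [|/language_Some_rcons]; last by rewrite -cats1; exact: language_prefix.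
move=> /language_codesP[ws Wws [p [q /codes_infix[->|]]]].
  by apply: (@language_prefix _ _ _ w0); exact: WX.
move=> [w /Wws/WX Xw /infixP[u [u' wE]]].
by move: Xw; rewrite wE; exact: language_factor.
Qed.

Lemma language_Some_None v q :
  language Y (map Some v ++ None :: q) <->
  language X v /\ language Y (None :: q).
Proof.
rewrite language_glue; split=> -[vX qY]; split=> //; last first.
  exact: language_Some_rcons.
by apply/language_Some; move: vX; rewrite -cats1; exact: language_prefix.
Qed.

(** An extension of a c-free word either stays c-free and is constrained by [X] alone, or reaches a
    first c, after which the past is forgotten. *)
Let lift_extensions (E : set (seq A)) : set (seq (option A)) :=
  [set t | (exists2 t1, E t1 & t = map Some t1) \/
    exists t1 q, [/\ E t1, language Y (None :: q) &
      t = map Some t1 ++ None :: q]].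

Lemma extensions_Some v : extensions (language Y) (map Some v) =
  lift_extensions (extensions (language X) v).
Proof.
apply/seteqP; split=> t; rewrite /lift_extensions /extensions /=.
  case: (split_first_None t) => [[t1 ->]|[t1 [q ->]]].
    by rewrite -map_cat => /language_Some ?; left; exists t1.
  by rewrite catA -map_cat => /language_Some_None[? ?]; right; exists t1, q.
move=> [[t1 h ->]|[t1 [q [h hq ->]]]].
  by rewrite -map_cat; apply/language_Some.
by rewrite catA -map_cat; apply/language_Some_None.
Qed.

Lemma extensions_None p q : language Y (rcons p None) ->
  extensions (language Y) (p ++ None :: q) =
  extensions (language Y) (None :: q).
Proof.
move=> pY; apply: eq_set => t; apply/propext.
by rewrite /extensions /= -catA /= language_glue; split=> [[]|].
Qed.

Lemma extensions_None0 p q : ~ language Y (rcons p None) ->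
  extensions (language Y) (p ++ None :: q) = set0.
Proof.
move=> pY; apply/seteqP; split=> // t.
by rewrite /extensions /= -catA /= => /language_glue[].
Qed.

Hypothesis sX : sofic X.

(** The empty set is included so that a word whose set of extensions is not blind is in the language
    of [Y]. *)
Let blind : set (set (seq (option A))) :=
  range (fun v => extensions (language Y) (map Some v)) `|` [set set0].

Lemma blind_finite : finite_set blind.
Proof.
rewrite /blind finite_setU; split; last exact: finite_set1.
apply: (@sub_finite_set _ _
    (lift_extensions @` range (extensions (language X)))).
  move=> _ [v _ <-]; exists (extensions (language X) v); first by exists v.
  by rewrite extensions_Some.
exact/finite_image/sofic_extensions_finite.
Qed.

Let after_None v := extensions (language Y) (None :: map Some v).

Lemma coded_extensions_finite :
  finite_set (range after_None) -> finite_set (range (extensions (language Y))).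
Proof.
move=> fin.
apply: (@sub_finite_set _ _ (blind `|` range after_None)); last first.
  by rewrite finite_setU; split=> //; exact: blind_finite.
move=> _ [z _ <-].
case: (split_last_None z) => [[v ->]|[p [v ->]]].
  by left; left; exists v.
have [pY|pY] := pselect (language Y (rcons p None)).
  by right; rewrite extensions_None//; exists v.
by left; right; exact: extensions_None0.
Qed.

Lemma after_None_finite n :
  (follower_n Y n #<= `I_n)%card -> finite_set (range after_None).
Proof.
move=> Yn; apply: contrapT => inf.
have cat_after v t :
    after_None (v ++ t) = [set s | after_None v (map Some t ++ s)].
  by rewrite /after_None map_cat -cat_cons extensions_cat.
have [] := choice (new_class_of_size blind_finite _ _ inf).
- by move=> v v' t vv'; rewrite !cat_after vv'.
- move=> v t; rewrite cat_after => -[[u _ <-]|->]; last by right.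
  by left; exists (u ++ t); rewrite // map_cat extensions_cat.
move=> v vP.
(* The blocks of one point of [X] serve as c-free padding of every length. *)
have [x Xx _] := WX Ww0.
have vY k : language Y (None :: map Some (v k)).
  have [_ vk _] := vP k.
  have [t vt] : after_None (v k) !=set0.
    by apply/set0P/eqP => v0; apply: vk; right.
  exact: language_prefix vt.
pose pad k := map Some (block x 0 k).
have padY k : language Y (rcons (pad k) None).
  exact/language_Some_rcons/language_block.
(* For [k < n] the length is (n-1-k) + 1 + k = n. With the c-free word [z n] this makes n+1 words of
   length [n]. *)
pose z k :=
  if (k < n)%N then pad (n.-1 - k)%N ++ None :: map Some (v k) else pad n.
have zE k : (k < n)%N -> extensions (language Y) (z k) = after_None (v k).
  by move=> kn; rewrite /z kn extensions_None.
have zn : blind (extensions (language Y) (z n)).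
  by rewrite /z ltnn; left; exists (block x 0 n).
have zY k : language_n Y n (z k).
  rewrite /z; case: ltnP => kn; split.
  - exact/language_glue.
  - by have [vk _ _] := vP k; rewrite size_cat /= !size_map size_iota vk; lia.
  - exact/language_Some/language_block.
  - by rewrite !size_map size_iota.
(* Equal follower sets give equal sets of extensions. For [j = n] this would make the class of [v i]
   blind; for [j < n] it would give [v j] the class of the shorter word [v i]. *)
have z_inj i j : (i < j <= n)%N -> follower Y (z i) <> follower Y (z j).
  move=> /andP[ij jn] fij.
  have : extensions (language Y) (z i) = extensions (language Y) (z j).
    by rewrite !extensions_follower fij.
  rewrite zE; last exact: leq_trans ij jn.
  move: jn; rewrite leq_eqVlt => /predU1P[jn|jn].
    rewrite jn => in_blind; have [_ + _] := vP i; apply.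
    by rewrite in_blind.
  rewrite zE//; have [vi _ _] := vP i; have [_ _] := vP j; apply.
  by rewrite vi.
have : (`I_n.+1 #<= `I_n)%card; last by rewrite card_le_II ltnn.
apply: card_le_trans Yn.
have /inj_card_eq/card_eqPle[_ /card_le_trans] :
    {in `I_n.+1 &, injective (fun k => follower Y (z k))}.
  move=> i j; rewrite !inE /= !ltnS => ilen jlen fij.
  case: (ltngtP i j) => // ij; exfalso.
    by apply: (@z_inj i j) => //; rewrite ij.
  by apply: (@z_inj j i) => //; rewrite ij.
apply; apply: subset_card_le => _ [k _ <-].
by exists (z k).
Qed.

End CodedSofic.

Theorem theorem4p12 (A : finType) (X : set (fullshift A)) (W : set (seq A))
    (n : nat) :
  sofic X ->
  W `<=` language X ->
  (forall v : seq A, language X v -> exists w : seq A, W w /\ suffix v w) ->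
  (0 < n)%N ->
  (follower_n (coded_subshift [set code_word w | w in W]) n #<= `I_n)%card ->
  sofic (coded_subshift [set code_word w | w in W]).
Proof.
move=> sX WX suffW _ Yn.
apply: finite_extensions_sofic; first exact: coded_subshift_subshift.
have [[w0 Ww0]|W0] := pselect (exists w0, W w0).
  have fin := after_None_finite Ww0 WX suffW sX Yn.
  exact: coded_extensions_finite Ww0 WX suffW sX fin.
(* Without code words [Y] is empty, and so is every set of extensions. *)
apply: (@sub_finite_set _ _ [set set0]) => // _ [z _ <-].
apply/seteqP; split=> // t.
rewrite /extensions /= language_closure => -[x [u [k [Vu _ _ _]]] _].
by have [w Ww _] := Vu 0; apply: W0; exists w.
Qed.
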